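(* Let $0\leq\varepsilon<1$ and $0<\varepsilon_0<1$. If $$h_t^2\Big(\tfrac{a_1^2}{h_1^2}+\ldots+\tfrac{a_n^2}{h_n^2}\Big)\leq\min\Big\{3(1-\varepsilon),\ \tfrac12\big[3-(1+8\varepsilon_0^2)^{1/2}\big]\Big\},$$ then both conditions $$\tfrac13 h_t^2\Big(\tfrac{a_1^2}{h_1^2}+\ldots+\tfrac{a_n^2}{h_n^2}\Big)\leq 1-\varepsilon\qquad\text{and}\qquad\tfrac14h_t^2A_{\mathbf h}\leq(1-\varepsilon_0^2)I\ \text{ in }H_h$$ are valid.
   Context: Let $n\geq1$, $a_k>0$, $X_k>0$ ($1\leq k\leq n$), $T>0$ be constants; $h_t=T/M$ with integer $M\geq2$. Space mesh: $x_{kl}=lh_k$, $0\leq l\leq N_k$, $h_k=X_k/N_k$, $N_k\geq2$ an integer; $\bar\omega_h$ is the product of the one-dimensional meshes $\{x_{kl}\}_{l=0}^{N_k}$, $1\leq k\leq n$, $\omega_h$ is the product of $\{x_{kl}\}_{l=1}^{N_k-1}$, and $\partial\omega_h=\bar\omega_h\setminus\omega_h$; $h=(h_1,\ldots,h_n)$, $\mathbf h=(h,h_t)$. In the direction $x_k$ on $\omega_h$: $(\Lambda_kw)_l=\frac1{h_k^2}(w_{l+1}-2w_l+w_{l-1})$ and $s_{kN}w_l=\frac1{12}(w_{l-1}+10w_l+w_{l+1})$, i.e. $s_{kN}=I+\frac1{12}h_k^2\Lambda_k$; $L_h=a_1^2\Lambda_1+\ldots+a_n^2\Lambda_n$; $I$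 is the identity. $H_h$ is the Euclidean space of real functions on $\bar\omega_h$ vanishing on $\partial\omega_h$ with inner product $(v,w)_h=h_1\cdots h_n\sum_{x\in\omega_h}v(x)w(x)$. The operators $\Lambda_k,s_{kN},L_h$ are regarded as operators in $H_h$ (values on $\partial\omega_h$ set to $0$); $s_{kN}$ is invertible in $H_h$. Operator inequalities in $H_h$ are in the sense of quadratic forms. $A_{\mathbf h}:=\big(I+\tfrac1{12}h_t^2L_h\big)\big(-a_1^2s_{1N}^{-1}\Lambda_1-\ldots-a_n^2s_{nN}^{-1}\Lambda_n\big)$ in $H_h$. *)

(* Defs.v *)
From HB Require Import structures.
From mathcomp Require Import all_boot all_order all_algebra.
From mathcomp Require Import reals.
From mathcomp Require Import ring lra.

Set Implicit Arguments.
Unset Strict Implicit.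
Unset Printing Implicit Defensive.

Import Order.TTheory GRing.Theory Num.Theory.
Local Open Scope ring_scope.

(* A point of \bar\omega_h is identified with its multi-index (l_1, ..., l_n),
   0 <= l_k <= N_k; its k-th coordinate is l_k * h_k. *)
Definition mesh (n : nat) (N : 'I_n -> nat) :=
  {dffun forall k : 'I_n, 'I_(N k).+1}.

Definition step (R : realType) (n : nat) (X : 'I_n -> R) (N : 'I_n -> nat)
  (k : 'I_n) : R := X k / (N k)%:R.

Definition omega (n : nat) (N : 'I_n -> nat) : {set mesh N} :=
  [set x : mesh N | [forall k, 0 < x k < N k]%N].

Definition domega (n : nat) (N : 'I_n -> nat) : {set mesh N} := ~: omega N.

(* R^o is R seen as a vector space over itself. *)
Definition meshfun (R : realType) (n : nat) (N : 'I_n -> nat) :=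
  {ffun mesh N -> R^o}.

(* Neighbours of x in the direction x_k.  They are only used at x in omega N,
   where inord does not truncate. *)
Definition next (n : nat) (N : 'I_n -> nat) (k : 'I_n) (x : mesh N) : mesh N :=
  finfun (dfwith x (inord (x k).+1 : 'I_(N k).+1)).

Definition prev (n : nat) (N : 'I_n -> nat) (k : 'I_n) (x : mesh N) : mesh N :=
  finfun (dfwith x (inord (x k).-1 : 'I_(N k).+1)).

Definition Lambda_fun (R : realType) (n : nat) (N : 'I_n -> nat)
    (h : 'I_n -> R) (k : 'I_n) (w : meshfun R N) : meshfun R N :=
  [ffun x => if x \in omega N
             then (h k ^+ 2)^-1 * (w (next k x) - 2 * w x + w (prev k x))
             else 0].

Definition numerov_fun (R : realType) (n : nat) (N : 'I_n -> nat)
    (k : 'I_n) (w : meshfun R N) : meshfun R N :=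
  [ffun x => if x \in omega N
             then 12^-1 * (w (prev k x) + 10 * w x + w (next k x))
             else 0].

Definition boundary_part (R : realType) (n : nat) (N : 'I_n -> nat)
    (w : meshfun R N) : meshfun R N :=
  [ffun x => if x \in domega N then w x else 0].

Definition Hspace (R : realType) (n : nat) (N : 'I_n -> nat) :
  {vspace meshfun R N} := lker (linfun (@boundary_part R n N)).

Notation Hh R N := (subvs_of (@Hspace R _ N)).

(* vsval : Hh R N -> meshfun R N is the inclusion; vsproj is its left inverse,
   which on Hspace only changes the type (vsprojK). *)
Definition op_of (R : realType) (n : nat) (N : 'I_n -> nat)
    (F : meshfun R N -> meshfun R N) : 'End(Hh R N) :=
  linfun (fun w : Hh R N => vsproj (Hspace R N) (F (vsval w))).

Definition Lambda (R : realType) (n : nat) (N : 'I_n -> nat)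
  (h : 'I_n -> R) (k : 'I_n) : 'End(Hh R N) := op_of (@Lambda_fun R n N h k).

Definition sN (R : realType) (n : nat) (N : 'I_n -> nat) (k : 'I_n) :
  'End(Hh R N) := op_of (@numerov_fun R n N k).

Definition Lop (R : realType) (n : nat) (N : 'I_n -> nat)
    (h a : 'I_n -> R) : 'End(Hh R N) :=
  \sum_k (a k ^+ 2) *: Lambda N h k.

(* The inverse in 'End is the two-sided inverse here, by sN_invertible below. *)
Definition Aop (R : realType) (n : nat) (N : 'I_n -> nat)
    (h a : 'I_n -> R) (ht : R) : 'End(Hh R N) :=
  ((\1 + (12^-1 * ht ^+ 2) *: Lop N h a) \o
   (\sum_k - ((a k ^+ 2) *: ((sN R N k)^-1 \o Lambda N h k))))%VF.

Definition inner (R : realType) (n : nat) (N : 'I_n -> nat)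
    (h : 'I_n -> R) (v w : Hh R N) : R :=
  (\prod_k h k) * \sum_(x in omega N) (vsval v x * vsval w x).

Definition op_le (R : realType) (n : nat) (N : 'I_n -> nat)
    (h : 'I_n -> R) (A B : 'End(Hh R N)) : Prop :=
  forall w : Hh R N, inner h (A w) w <= inner h (B w) w.

(* The lemmas below certify that linfun, vsproj and the inverse in 'End are
   applied within their domains of validity. *)

Lemma boundary_part_linear (R : realType) (n : nat) (N : 'I_n -> nat) :
  linear (@boundary_part R n N).
Proof.
move=> c u v; apply/ffunP => x; rewrite !ffunE.
by case: ifP => // _; rewrite scaler0 addr0.
Qed.

HB.instance Definition _ (R : realType) (n : nat) (N : 'I_n -> nat) :=
  GRing.isLinear.Build R (meshfun R N) (meshfun R N) _ (@boundary_part R n N)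
    (@boundary_part_linear R n N).

Lemma memHspace (R : realType) (n : nat) (N : 'I_n -> nat) (w : meshfun R N) :
  reflect (forall x, x \in domega N -> w x = 0) (w \in Hspace R N).
Proof.
rewrite memv_ker lfunE /=; apply: (iffP eqP) => [/ffunP H x xb|H].
  by have := H x; rewrite !ffunE xb.
by apply/ffunP => x; rewrite !ffunE; case: ifP => // /H.
Qed.

Lemma Lambda_fun_linear (R : realType) (n : nat) (N : 'I_n -> nat)
  (h : 'I_n -> R) (k : 'I_n) : linear (@Lambda_fun R n N h k).
Proof.
move=> c u v; apply/ffunP => x; rewrite !ffunE.
case: ifP => _; last by rewrite scaler0 addr0.
by rewrite /GRing.scale /=; ring.
Qed.

Lemma numerov_fun_linear (R : realType) (n : nat) (N : 'I_n -> nat)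
  (k : 'I_n) : linear (@numerov_fun R n N k).
Proof.
move=> c u v; apply/ffunP => x; rewrite !ffunE.
case: ifP => _; last by rewrite scaler0 addr0.
by rewrite /GRing.scale /=; ring.
Qed.

Lemma op_ofE (R : realType) (n : nat) (N : 'I_n -> nat)
    (F : meshfun R N -> meshfun R N) :
    linear F -> (forall w x, x \in domega N -> F w x = 0) ->
  forall w : Hh R N, vsval (op_of F w) = F (vsval w).
Proof.
move=> Fl F0 w.
pose G := fun w : Hh R N => vsproj (Hspace R N) (F (vsval w)).
have Gl : linear G by move=> c u v; rewrite /G linearP Fl linearP.
pose GL := GRing.isLinear.Build R (Hh R N) (Hh R N) _ G Gl.
pose G' : {linear Hh R N -> Hh R N} := HB.pack G GL.
rewrite /op_of (lfunE G') /= /G vsprojK //.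
by apply/memHspace => x; apply: F0.
Qed.

Lemma LambdaE (R : realType) (n : nat) (N : 'I_n -> nat)
    (h : 'I_n -> R) (k : 'I_n) (w : Hh R N) :
  vsval (Lambda N h k w) = Lambda_fun h k (vsval w).
Proof.
apply: op_ofE => [|{}w x]; first exact: Lambda_fun_linear.
by rewrite inE ffunE => /negbTE ->.
Qed.

Lemma sNE (R : realType) (n : nat) (N : 'I_n -> nat) (k : 'I_n) (w : Hh R N) :
  vsval (sN R N k w) = numerov_fun k (vsval w).
Proof.
apply: op_ofE => [|{}w x]; first exact: numerov_fun_linear.
by rewrite inE ffunE => /negbTE ->.
Qed.

Lemma sN_Lambda (R : realType) (n : nat) (N : 'I_n -> nat)
    (h : 'I_n -> R) (k : 'I_n) :
  h k != 0 -> sN R N k = (\1 + (12^-1 * h k ^+ 2) *: Lambda N h k)%VF.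
Proof.
move=> hk0; apply/lfunP => w; apply/val_inj/ffunP => x.
rewrite /= sNE add_lfunE id_lfunE scale_lfunE linearD linearZ /= LambdaE !ffunE.
case: ifP => [xo|/negbT xo].
  by rewrite /GRing.scale /=; field.
rewrite scaler0 addr0; apply/esym/(elimT (memHspace _) (subvsP w)).
by rewrite inE.
Qed.

Lemma sN_invertible (R : realType) (n : nat) (N : 'I_n -> nat) (k : 'I_n) :
  lker (sN R N k) = 0%VS.
Proof.
apply/eqP; rewrite -subv0; apply/subvP => w; rewrite memv_ker memv0 => /eqP w0.
pose u x : R := vsval w x.
have wb x : x \in domega N -> u x = 0 by apply: (elimT (memHspace _) (subvsP w)).
have E x : x \in omega N -> 10 * u x = - (u (prev k x) + u (next k x)).
  move=> xo; have := sNE k w; rewrite w0 => /ffunP /(_ x).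
  rewrite linear0 !ffunE xo => /esym H.
  have {}H : u (prev k x) + 10 * u x + u (next k x) = 0.
    by move/eqP: H; rewrite mulf_eq0 invr_eq0 pnatr_eq0 /= => /eqP.
  lra.
apply/eqP/val_inj/ffunP => x1.
rewrite (_ : val 0 = 0 :> meshfun R N) ?[RHS]ffunE; last exact: (linear0 vsval).
suff: u x1 = 0 by [].
have [x _ /= xmax] := @Order.TotalTheory.arg_maxP _ R _ x1 xpredT
  (fun x => `|u x|) isT.
apply/normr0_eq0/eqP; rewrite eq_le normr_ge0 andbT.
apply: le_trans (xmax x1 isT) _.
have [xo|xo] := boolP (x \in omega N); last by rewrite (wb x) ?normr0 // inE.
have := congr1 Num.norm (E _ xo); rewrite normrN normrM ger0_norm // => H.
have := ler_normD (u (prev k x)) (u (next k x)).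
have := xmax (prev k x) isT; have := xmax (next k x) isT.
rewrite -H; have := normr_ge0 (u x); lra.
Qed.

Lemma sN_inv (R : realType) (n : nat) (N : 'I_n -> nat) (k : 'I_n) :
  ((sN R N k)^-1 \o sN R N k = \1 /\ sN R N k \o (sN R N k)^-1 = \1)%VF.
Proof.
have H := introT eqP (sN_invertible R N k).
by split; [apply: lker0_compVf | apply: lker0_compfV].
Qed.

(* Main.v *)
Require Import Defs.
From HB Require Import structures.
From mathcomp Require Import all_boot all_order all_algebra.
From mathcomp Require Import reals.
From mathcomp Require Import ring lra.

Set Implicit Arguments.
Unset Strict Implicit.
Unset Printing Implicit Defensive.

Import Order.TTheory GRing.Theory Num.Theory.
Local Open Scope ring_scope.

(** Put [Y_k = - (h_k^2 / 4) Lambda_k] and [c_k = h_t^2 a_k^2 / h_k^2], with sum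
    [C <= 1].  The [Y_k] are commuting, self-adjoint and between [0] and [I],
    [s_kN = I - Y_k / 3], and [(h_t^2 / 4) A = (I - P / 3) Q] with
    [P = sum c_k Y_k] and [Q = sum c_k s_kN^-1 Y_k].  As
    [s_kN^-1 Y_k <= (3 / 2) Y_k] and [P <= C], this is at most
    [(3 / 2) (I - P / 3) P <= (3 / 2) (C - C^2 / 3)], and the last bound is
    [<= 1 - eps0^2] exactly when [C] is outside the two roots of
    [C^2 - 3 C + 2 (1 - eps0^2)].  Instead of a joint eigenbasis, the argument
    uses only that the product of commuting nonnegative operators is
    nonnegative. *)

(** * Algebra of self-adjoint, nonnegative and commuting operators *)

Section PositiveOperators.

Variables (R : archiRealFieldType) (V : vectType R) (ip : V -> V -> R).
Hypothesis ipC : forall u v, ip u v = ip v u.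
Hypothesis ipDl : forall u v w, ip (u + v) w = ip u w + ip v w.
Hypothesis ipZl : forall c u w, ip (c *: u) w = c * ip u w.
Hypothesis ip_ge0 : forall w, 0 <= ip w w.

Implicit Types (A B D : 'End(V)).

Lemma ipDr u v w : ip w (u + v) = ip w u + ip w v.
Proof. by rewrite ipC ipDl !(ipC w). Qed.

Lemma ipZr c u w : ip w (c *: u) = c * ip w u.
Proof. by rewrite ipC ipZl (ipC w). Qed.

Lemma ipNl u w : ip (- u) w = - ip u w.
Proof. by rewrite -scaleN1r ipZl mulN1r. Qed.

Lemma ipNr u w : ip w (- u) = - ip w u.
Proof. by rewrite -scaleN1r ipZr mulN1r. Qed.

Lemma ip0l w : ip 0 w = 0.
Proof. by rewrite -(scale0r 0) ipZl mul0r. Qed.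

Lemma ip_suml (I : finType) (F : I -> V) w : ip (\sum_i F i) w = \sum_i ip (F i) w.
Proof.
by elim/big_rec2: _ => [|i x y _ <-]; [exact: ip0l | rewrite ipDl].
Qed.

Definition ipE := (ipDl, ipDr, ipNl, ipNr, ipZl, ipZr).

Definition opE := (comp_lfunE, scale_lfunE, opp_lfunE, add_lfunE, id_lfunE).

Definition selfadj A := forall v w, ip (A v) w = ip v (A w).
Definition psd A := forall w, 0 <= ip (A w) w.
Definition comm A B := forall v, A (B v) = B (A v).
(** The name is that of quantum measurement theory. The bound by [\1] is what keeps the recursion A
    - A^2 nonnegative. *)
Definition effect A := [/\ selfadj A, psd A & psd (\1%VF - A)].

Lemma comm_sym A B : comm A B -> comm B A.
Proof. by move=> AB v; rewrite AB. Qed.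

Lemma comm_refl A : comm A A.
Proof. by []. Qed.

Lemma comm1 A : comm A \1%VF.
Proof. by move=> v; rewrite !opE. Qed.

Lemma commD A B D : comm A B -> comm A D -> comm A (B + D).
Proof. by move=> AB AD v; rewrite !opE linearD /= AB AD. Qed.

Lemma commZ c A B : comm A B -> comm A (c *: B).
Proof. by move=> AB v; rewrite !opE linearZ /= AB. Qed.

Lemma commN A B : comm A B -> comm A (- B).
Proof. by move=> AB v; rewrite !opE linearN /= AB. Qed.

Lemma commM A B D : comm A B -> comm A D -> comm A (B \o D)%VF.
Proof. by move=> AB AD v; rewrite !opE AB AD. Qed.

Lemma comm_suml (I : finType) (F : I -> 'End(V)) A :
  (forall i, comm A (F i)) -> comm A (\sum_i F i).
Proof.
move=> AF v; rewrite !sum_lfunE linear_sum /=.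
by apply: eq_bigr => i _; rewrite AF.
Qed.

Lemma comm_inv A B D : comm A B -> cancel A D -> cancel D A -> comm D B.
Proof. by move=> AB AD DA v; rewrite -{1}(DA v) -AB AD. Qed.

Lemma selfadj1 : selfadj \1%VF.
Proof. by move=> v w; rewrite !opE. Qed.

Lemma selfadjD A B : selfadj A -> selfadj B -> selfadj (A + B).
Proof. by move=> sA sB v w; rewrite !opE !ipE sA sB. Qed.

Lemma selfadjZ c A : selfadj A -> selfadj (c *: A).
Proof. by move=> sA v w; rewrite !opE !ipE sA. Qed.

Lemma selfadjN A : selfadj A -> selfadj (- A).
Proof. by move=> sA v w; rewrite !opE !ipE sA. Qed.

Lemma selfadjM A B : selfadj A -> selfadj B -> comm A B -> selfadj (A \o B)%VF.
Proof. by move=> sA sB AB v w; rewrite !opE sA sB AB. Qed.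

Lemma selfadj_sum (I : finType) (F : I -> 'End(V)) :
  (forall i, selfadj (F i)) -> selfadj (\sum_i F i).
Proof.
move=> sF; apply: (big_ind selfadj) => // [|A B]; last exact: selfadjD.
by move=> v w; rewrite !zero_lfunE ip0l ipC ip0l.
Qed.

Lemma selfadj_inv A D : selfadj A -> cancel D A -> selfadj D.
Proof. by move=> sA DA v w; rewrite -{1}(DA w) -sA DA. Qed.

Lemma psdD A B : psd A -> psd B -> psd (A + B).
Proof. by move=> pA pB w; rewrite !opE ipE addr_ge0. Qed.

Lemma psdZ c A : 0 <= c -> psd A -> psd (c *: A).
Proof. by move=> c0 pA w; rewrite !opE ipE mulr_ge0. Qed.

Lemma psd_sum (I : finType) (F : I -> 'End(V)) :
  (forall i, psd (F i)) -> psd (\sum_i F i).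
Proof. by move=> pF w; rewrite sum_lfunE ip_suml sumr_ge0 // => i _; exact: pF. Qed.

(** * Operators between 0 and I, and products of commuting nonnegative operators *)

Lemma effect_ip_le A w : effect A -> ip (A w) w <= ip w w.
Proof. by move=> [_ _ /(_ w)]; rewrite !opE !ipE; lra. Qed.

Lemma effectC A : effect A -> effect (\1%VF - A).
Proof.
case=> sA pA pA'; split=> //.
  by apply: selfadjD; [exact: selfadj1 | exact: selfadjN].
by rewrite subKr.
Qed.

(** Comes from A - A^2 = A (I - A) A + (I - A) A (I - A): add the form of I - A at A w and the form
    of A at w - A w. *)
Lemma effect_compl_comp A w : effect A -> 0 <= ip (A w) w - ip (A (A w)) w.
Proof.
case=> sA pA pA'.
have := pA (w - A w); have := pA' (A w).
rewrite !opE !linearB /= !ipE; lra.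
Qed.

Lemma effect_step A : effect A -> effect (A - (A \o A)%VF).
Proof.
move=> eA; have [sA pA pA'] := eA; split.
- by apply: selfadjD => //; apply/selfadjN/selfadjM.
- by move=> w; have := effect_compl_comp w eA; rewrite !opE !ipE.
- move=> w; have := pA' w; have := ip_ge0 (A w).
  by rewrite !opE !ipE (sA (A w) w); lra.
Qed.

(** With u = A w, the left side is |u|^2 - 2 <A u, u> + |A u|^2, where |A u|^2 <= <A u, u> by
    [effect_compl_comp] and <A u, u> >= 0. Hence the norms |A_m w| of the Riesz recursion do not
    increase. *)
Lemma effect_step_norm A w : effect A ->
  ip (A w - A (A w)) (A w - A (A w)) <= ip (A w) (A w).
Proof.
move=> eA; have [sA pA pA'] := eA.
have := effect_compl_comp (A w) eA; have := pA (A w).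
rewrite !ipE (sA (A (A w)) (A w)) (ipC (A w) (A (A w))); lra.
Qed.

(* Riesz: with A_0 = A and A_(n+1) = A_n - A_n^2, one has
   A = A_0^2 + ... + A_(m-1)^2 + A_m and m |A_m w|^2 <= |w|^2, so that
   <A B w, w> is a limit of the sums of <B A_i w, A_i w>. *)
Definition riesz A m := iter m (fun D => D - (D \o D)%VF) A.

Lemma riesz_effect A m : effect A -> effect (riesz A m).
Proof. by move=> eA; elim: m => [|m IH] //=; exact: effect_step. Qed.

(** Step i lowers <A_i w, w> by exactly |A_i w|^2. Since these norms do not increase, m steps lower
    it by at least m |A_m w|^2. *)
Lemma riesz_norm A m w : effect A ->
  ip (riesz A m w) w + m%:R * ip (riesz A m w) (riesz A m w) <= ip (A w) w.
Proof.
move=> eA; elim: m => [|m IH]; first by rewrite mul0r addr0.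
have em := riesz_effect m eA; have [sm _ _] := em.
apply: le_trans IH => /=; have := effect_step_norm w em.
rewrite !opE -/(riesz A m); set u := riesz A m w - _ => H.
have -> : ip u w = ip (riesz A m w) w - ip (riesz A m w) (riesz A m w).
  by rewrite /u ipDl ipNl (sm (riesz A m w) w).
have := ler_wpM2l (ler0n R m) H; rewrite -natr1; lra.
Qed.

Lemma riesz_comm A B m : comm A B -> comm (riesz A m) B.
Proof.
move=> AB; elim: m => [|m IH] //=; apply: comm_sym.
by apply: commD; [|apply/commN/commM]; exact: comm_sym.
Qed.

Lemma riesz_psd A B m w : effect A -> psd B -> comm A B ->
  ip (B (riesz A m w)) w <= ip (B (A w)) w.
Proof.
move=> eA pB AB; elim: m => [|m IH] //=.
apply: le_trans IH; have [sm _ _] := riesz_effect m eA.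
rewrite !opE linearB ipDl /= -/(riesz A m).
rewrite -(riesz_comm m AB (riesz A m w)). rewrite ipNl (sm (B _)).
by have := pB (riesz A m w); lra.
Qed.

Lemma psdM A B : effect A -> selfadj B -> psd B -> comm A B -> psd (A \o B)%VF.
Proof.
move=> eA sB pB AB w; rewrite !opE AB leNgt; apply/negP.
set d := ip (B (A w)) w => d0.
set b := ip (B w) (B w).
have b0 : 0 <= b := ip_ge0 _.
(* The limit is replaced by a quantitative contradiction. For u = A_(m+1) w one has <B u, w> <= d,
   so this t turns |t u + B w|^2 >= 0 into t^2 |u|^2 >= b + 2. *)
pose t := (b + 1) / - d.
have td : t * d = - (b + 1) by rewrite /t; field; lra.
(* For such m, (m + 1) |u|^2 <= |w|^2 forces t^2 |u|^2 < 1. *)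
have [m Hm] : exists m : nat, t ^+ 2 * ip w w < m.+1%:R.
  have := archi_boundP (mulr_ge0 (sqr_ge0 t) (ip_ge0 w)).
  set m := Num.bound _ => Hm; exists m; apply: lt_le_trans Hm _.
  by rewrite ler_nat.
have Hd := riesz_psd m.+1 w eA pB AB; rewrite -/d in Hd.
have Hn := riesz_norm m.+1 w eA.
have [_ /(_ w) p0 _] := riesz_effect m.+1 eA.
have A1 := effect_ip_le w eA.
move: Hd Hn p0; set u := riesz A m.+1 w => Hd Hn p0.
have Hs : 0 <= t ^+ 2 * ip u u + 2 * t * ip (B u) w + b.
  have := ip_ge0 (t *: u + B w).
  by rewrite !ipE (ipC (B w) u) -(sB u w) -/b; lra.
have t0 : 0 <= t by rewrite divr_ge0 //; lra.
have Hs2 : t * ip (B u) w <= - (b + 1) by rewrite -td ler_wpM2l.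
have Hu : m.+1%:R * ip u u <= ip w w by lra.
have : m.+1%:R * (t ^+ 2 * ip u u) <= t ^+ 2 * ip w w.
  by rewrite mulrCA ler_wpM2l ?sqr_ge0.
have : m.+1%:R * 1 <= m.+1%:R * (t ^+ 2 * ip u u).
  by rewrite ler_pM2l ?ltr0Sn //; lra.
lra.
Qed.

Lemma effectZ c A : 0 <= c <= 1 -> effect A -> effect (c *: A).
Proof.
move=> /andP[c0 c1] eA; have [sA pA _] := eA; split.
- exact: selfadjZ.
- exact: psdZ.
- move=> w; rewrite !opE !ipE subr_ge0.
  apply: le_trans (effect_ip_le w eA).
  by rewrite -[leRHS]mul1r ler_wpM2r // pA.
Qed.

(** * The abstract Numerov estimate, with [S i] in the role of the inverse of s_kN *)

Section Numerov.

Variables (I : finType) (Y S : I -> 'End(V)) (c : I -> R).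
Hypothesis eY : forall i, effect (Y i).
Hypothesis cY : forall i j, comm (Y i) (Y j).
Hypothesis numerovK : forall i, cancel (\1 - 3^-1 *: Y i)%VF (S i).
Hypothesis SK : forall i, cancel (S i) (\1 - 3^-1 *: Y i)%VF.
Hypothesis c0 : forall i, 0 <= c i.
Hypothesis c1 : \sum_i c i <= 1.

Let C := \sum_i c i.
Let P := \sum_i c i *: Y i.
Let Q := \sum_i c i *: (S i \o Y i)%VF.

Lemma numerov_effect i : effect (\1 - 3^-1 *: Y i)%VF.
Proof. by apply/effectC/effectZ => //; lra. Qed.

Lemma comm_numerov_inv i j : comm (S i) (Y j).
Proof.
apply: comm_inv (@numerovK i) (@SK i); apply: comm_sym.
by apply: commD; [exact: comm1 | apply/commN/commZ].
Qed.

Lemma weighted_sum_effect : effect P.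
Proof.
split.
- by apply: selfadj_sum => i; apply: selfadjZ; have [] := eY i.
- by apply: psd_sum => i; apply: psdZ => //; have [] := eY i.
move=> w; rewrite !opE !ipE subr_ge0 sum_lfunE ip_suml.
apply: (@le_trans _ _ (C * ip w w)); last by rewrite -[leRHS]mul1r ler_wpM2r.
rewrite mulr_suml; apply: ler_sum => i _.
by rewrite !opE ipE ler_wpM2l // effect_ip_le.
Qed.

Lemma weighted_sum_le w : ip (P w) w <= C * ip w w.
Proof.
rewrite sum_lfunE ip_suml mulr_suml; apply: ler_sum => i _.
by rewrite !opE ipE ler_wpM2l // effect_ip_le.
Qed.

(* 3/2 Y - S Y = 1/2 S Y (1 - Y), whose form at w is that of
   (1 - Y/3) Y (1 - Y) at S w. *)
Lemma numerov_inv_gap_psd i : psd ((3 / 2) *: Y i - (S i \o Y i)%VF).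
Proof.
have [sY pY _] := eY i; have [s's p's p'p] := effectC (eY i).
have cYC : comm (Y i) (\1 - Y i)%VF.
  by apply: commD; [exact: comm1 | exact/commN].
move=> w; set v := S i w.
have -> : w = v - 3^-1 *: Y i v by rewrite -{1}(SK i w) !opE.
have : 0 <= ip (((\1 - 3^-1 *: Y i) \o (Y i \o (\1 - Y i)))%VF v) v.
  apply: psdM; first exact: numerov_effect.
  - exact: selfadjM.
  - exact: psdM.
  - apply: comm_sym; apply: commD; first exact: comm1.
    apply/commN/commZ/comm_sym/commM => //.
rewrite !opE (comm_numerov_inv i i).
have -> : S i (v - 3^-1 *: Y i v) = v.
  by rewrite -[RHS](numerovK i v) !opE.
rewrite !linearB !linearZ /= !ipE.
rewrite (sY (Y i v) v) (sY (Y i (Y i v)) v).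
by move: (ip (Y i v) v) => x; lra.
Qed.

Lemma numerov_bound w :
  ip (((\1 - 3^-1 *: P) \o Q)%VF w) w <= 3 / 2 * (C - C ^+ 2 / 3) * ip w w.
Proof.
have eP := weighted_sum_effect; have [sP pP _] := eP.
have C0 : 0 <= C by apply: sumr_ge0.
have cYP i : comm (Y i) P by apply: comm_suml => j; apply: commZ.
have cSP i : comm (S i) P.
  by apply: comm_suml => j; apply/commZ/comm_numerov_inv.
have cPQ : comm P Q.
  by apply: comm_suml => i; apply/commZ/commM; exact: comm_sym.
have sQ : selfadj Q.
  apply: selfadj_sum => i; apply/selfadjZ/selfadjM; last exact: comm_numerov_inv.
    by have [s's _ _] := numerov_effect i; apply: selfadj_inv s's (SK i).
  by have [] := eY i.
(* This replaces Q by (3/2) P in the product; the gap (3/2) P - Q is nonnegative term by term. *)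
have G0 : 0 <= ip (((\1 - 3^-1 *: P) \o ((3 / 2) *: P - Q))%VF w) w.
  apply: psdM.
  - by apply/effectC/effectZ => //; lra.
  - by apply: selfadjD; [exact: selfadjZ | exact: selfadjN].
  - move=> u; rewrite !opE !ipE !sum_lfunE !ip_suml mulr_sumr -sumrB.
    apply: sumr_ge0 => i _; have := numerov_inv_gap_psd i u.
    by rewrite !opE !ipE => /(mulr_ge0 (c0 i)); lra.
  - apply: comm_sym; apply: commD; first exact: comm1.
    apply/commN/commZ/comm_sym; apply: commD; first exact: commZ.
    exact: commN.
(* For f(p) = p - p^2 / 3, f(C) - f(p) = (1 - (C + p) / 3) (C - p). The first factor is an effect
   because C <= 1 and P <= I. *)
have F0 : 0 <= ip (((\1 - 3^-1 *: (C *: \1 + P)) \o (C *: \1 - P))%VF w) w.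
  apply: psdM.
  - apply: effectC; split.
    + by apply/selfadjZ/selfadjD => //; apply/selfadjZ/selfadj1.
    + apply/psdZ/psdD => //; first lra.
      by apply: psdZ => // u; rewrite !opE.
    + move=> u; have := effect_ip_le u eP.
      have := ler_wpM2r (ip_ge0 u) c1; rewrite -/C.
      by rewrite !opE !ipE; have := ip_ge0 u; lra.
  - by apply: selfadjD; [exact/selfadjZ/selfadj1 | exact: selfadjN].
  - by move=> u; have := weighted_sum_le u; rewrite !opE !ipE; lra.
  - apply: comm_sym; apply: commD; first exact: comm1.
    apply/commN/commZ; apply: commD; first exact/commZ/comm1.
    by apply/comm_sym/commD; [exact/commZ/comm1 | exact/commN].
move: G0 F0; rewrite !opE !linearB !linearZ /= !ipE.
lra.
Qed.

End Numerov.

End PositiveOperators.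

(* path.v also defines next and prev. *)
Local Notation next := Defs.next.
Local Notation prev := Defs.prev.

(** * Index shifts on the mesh and summation by parts *)

Section Mesh.

Variables (n : nat) (N : 'I_n -> nat).
Implicit Types (x y : mesh N) (k j : 'I_n).

(** [next] and [prev] are convertible to instances of [upd], so all commutations of shifts reduce to
    [updC]. *)
Definition upd k (i : 'I_(N k).+1) x : mesh N := finfun (dfwith x i).

Lemma upd_in k (i : 'I_(N k).+1) x : upd i x k = i.
Proof. by rewrite /upd ffunE dfwith_in. Qed.

Lemma upd_out k j (i : 'I_(N k).+1) x : k != j -> upd i x j = x j.
Proof. by move=> kj; rewrite /upd ffunE dfwith_out. Qed.

Lemma updC k j (i : 'I_(N k).+1) (i' : 'I_(N j).+1) x : k != j ->
  upd i (upd i' x) = upd i' (upd i x).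
Proof.
move=> kj; apply/ffunP => l.
have [kl|kl] := eqVneq k l.
  by case: l / kl; rewrite upd_in upd_out 1?eq_sym // upd_in.
rewrite upd_out //; have [jl|jl] := eqVneq j l.
  by case: l / jl kl => _; rewrite !upd_in.
by rewrite !upd_out.
Qed.

Lemma nextE k x : next k x = upd (inord (x k).+1 : 'I_(N k).+1) x.
Proof. by []. Qed.

Lemma prevE k x : prev k x = upd (inord (x k).-1 : 'I_(N k).+1) x.
Proof. by []. Qed.

Lemma upd_id k (i : 'I_(N k).+1) x (i' : 'I_(N k).+1) :
  i' = x k -> upd i' (upd i x) = x.
Proof.
move=> ->; apply/ffunP => l; rewrite ffunE.
by case: dfwithP => [//|l' kl]; rewrite upd_out.
Qed.

Lemma omega_coord k x : x \in omega N -> (0 < x k < N k)%N.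
Proof. by rewrite inE => /forallP. Qed.

Lemma nextK k x : (x k < N k)%N -> prev k (next k x) = x.
Proof.
move=> xk; rewrite prevE; apply: upd_id; apply: val_inj.
by rewrite nextE upd_in /= !inordK //=.
Qed.

Lemma prevK k x : (0 < x k)%N -> next k (prev k x) = x.
Proof.
move=> xk; rewrite nextE; apply: upd_id; apply: val_inj.
have xN : ((x k).-1 < (N k).+1)%N by apply: leq_ltn_trans (leq_pred _) (ltn_ord _).
by rewrite prevE upd_in (inordK xN) prednK // inord_val.
Qed.

Lemma next_omega k x : next k x \in omega N -> (x k < N k)%N.
Proof.
move=> /(omega_coord k); rewrite nextE upd_in => /andP[H _].
(* If [x k] were [N k], the successor would be out of range and [inord] would return 0, a boundary
   index. *)
rewrite ltnNge; apply: contraL H => Nx; rewrite -leqNgt leqn0.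
by rewrite /inord /insubd insubN // -leqNgt ltnS.
Qed.

(** Summation by parts: terms whose shifted point leaves [omega N] vanish, and on the others
    [next k] and [prev k] are mutually inverse. *)
Lemma sum_shift (R : realType) (k : 'I_n) (F G : mesh N -> R) :
    (forall x, x \notin omega N -> F x = 0) ->
    (forall x, x \notin omega N -> G x = 0) ->
  \sum_(x in omega N) F (next k x) * G x = \sum_(x in omega N) F x * G (prev k x).
Proof.
move=> F0 G0.
rewrite (bigID (fun x => next k x \in omega N)) /= [X in _ + X]big1 ?addr0; last first.
  by move=> x /andP[_ /F0 ->]; rewrite mul0r.
rewrite [RHS](bigID (fun x => prev k x \in omega N)) /= [X in _ = _ + X]big1 ?addr0;
  last by move=> x /andP[_ /G0 ->]; rewrite mulr0.
rewrite [RHS](reindex_onto (next k) (prev k)) /=; last first.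
  by move=> y /andP[/(omega_coord k)/andP[y0 _] _]; exact: prevK.
apply: eq_big => [x|x /andP[xo xo']]; last first.
  by rewrite nextK //; apply: next_omega.
have [xN|xN] := boolP (next k x \in omega N); last by rewrite andbF.
by rewrite nextK ?eqxx ?andbT //; apply: next_omega.
Qed.


(** * The normalised difference operators in H_h *)

Section Laplacian.

Variables (R : realType) (h : 'I_n -> R).
Hypothesis h_gt0 : forall k, 0 < h k.
Implicit Types (u v w : Hh R N).

Lemma vsval_out w x : x \notin omega N -> vsval w x = 0.
Proof. by move=> xo; apply: (elimT (memHspace _) (subvsP w)); rewrite inE. Qed.

Lemma innerC u v : inner h u v = inner h v u.
Proof. by rewrite /inner; congr (_ * _); apply: eq_bigr => x _; rewrite mulrC. Qed.

Lemma innerDl u v w : inner h (u + v) w = inner h u w + inner h v w.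
Proof.
rewrite /inner -mulrDr -big_split /=; congr (_ * _); apply: eq_bigr => x _.
by rewrite ffunE mulrDl.
Qed.

Lemma innerZl c u w : inner h (c *: u) w = c * inner h u w.
Proof.
rewrite /inner mulrCA; congr (_ * _); rewrite mulr_sumr; apply: eq_bigr => x _.
by rewrite linearZ ffunE -mulrA.
Qed.

Lemma prod_step_ge0 : 0 <= \prod_k h k.
Proof. by apply: prodr_ge0 => k _; exact: ltW. Qed.

Lemma inner_ge0 w : 0 <= inner h w w.
Proof.
apply: mulr_ge0; first exact: prod_step_ge0.
by apply: sumr_ge0 => x _; exact: sqr_ge0.
Qed.

(** This is Y_k; the factor is chosen because the form of - Lambda_k lies between 0 and 4 /
    h_k^2. *)
Definition scaled_laplacian k : 'End(Hh R N) := (- (h k ^+ 2 / 4)) *: Lambda N h k.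

Lemma scaled_laplacianE k w x : x \in omega N ->
  vsval (scaled_laplacian k w) x
  = 4^-1 * (2 * vsval w x - vsval w (next k x) - vsval w (prev k x)).
Proof.
move=> xo; rewrite scale_lfunE linearZ /= LambdaE !ffunE xo /GRing.scale /=.
by field; rewrite gt_eqF.
Qed.

(** Moving the [prev] shift onto [w] leaves an expression visibly symmetric in [v] and [w], which
    gives self-adjointness. *)
Lemma inner_scaled_laplacian k v w :
  inner h (scaled_laplacian k v) w = \prod_k h k * (4^-1 *
    (2 * (\sum_(x in omega N) vsval v x * vsval w x)
     - \sum_(x in omega N) vsval v (next k x) * vsval w x
     - \sum_(x in omega N) vsval w (next k x) * vsval v x)).
Proof.
rewrite [X in _ - _ - X]sum_shift; try exact: vsval_out.
rewrite /inner; congr (_ * _); rewrite mulr_sumr -!sumrB mulr_sumr.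
apply: eq_bigr => x xo; rewrite scaled_laplacianE //; ring.
Qed.

Lemma sum_sqr_next_le k w :
  \sum_(x in omega N) vsval w (next k x) ^+ 2 <= \sum_(x in omega N) vsval w x ^+ 2.
Proof.
(* The indicator of [omega N] stands for the constant 1, since [sum_shift] needs factors vanishing
   outside [omega N]. *)
pose G x : R := (x \in omega N)%:R.
have G0 x : x \notin omega N -> G x = 0 by rewrite /G => /negbTE ->.
have w0 x : x \notin omega N -> vsval w x ^+ 2 = 0 :> R.
  by move=> /vsval_out ->; rewrite expr0n.
have -> : \sum_(x in omega N) vsval w (next k x) ^+ 2
    = \sum_(x in omega N) vsval w (next k x) ^+ 2 * G x.
  by apply: eq_bigr => x xo; rewrite /G xo mulr1.
rewrite (sum_shift k w0 G0); apply: ler_sum => x _.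
by rewrite /G ler_piMr ?sqr_ge0 // lern1 leq_b1.
Qed.

Lemma scaled_laplacian_effect k : effect (inner h) (scaled_laplacian k).
Proof.
(* Expand the sum of (w(next x) - s w(x))^2. The sign s = 1 gives nonnegativity, s = -1 the upper
   bound by I. *)
have bound (s : R) w : s ^+ 2 = 1 ->
    0 <= \sum_(x in omega N) vsval w x * vsval w x
         - s * \sum_(x in omega N) vsval w (next k x) * vsval w x.
  move=> s2; have le := sum_sqr_next_le k w.
  have : 0 <= \sum_(x in omega N) (vsval w (next k x) - s * vsval w x) ^+ 2.
    by apply: sumr_ge0 => x _; exact: sqr_ge0.
  have -> : \sum_(x in omega N) (vsval w (next k x) - s * vsval w x) ^+ 2 =
      \sum_(x in omega N) vsval w (next k x) ^+ 2
      + \sum_(x in omega N) vsval w x ^+ 2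
      - 2 * s * \sum_(x in omega N) vsval w (next k x) * vsval w x.
    rewrite mulr_sumr -big_split -sumrB /=; apply: eq_bigr => x _.
    by rewrite sqrrB exprMn s2; ring.
  have -> : \sum_(x in omega N) vsval w x * vsval w x
      = \sum_(x in omega N) vsval w x ^+ 2 by [].
  lra.
split.
- move=> v w; rewrite (innerC v) !inner_scaled_laplacian; congr (_ * (_ * _)).
  rewrite addrAC; congr (_ * _ - _ - _).
  by apply: eq_bigr => x _; rewrite mulrC.
- move=> w; rewrite inner_scaled_laplacian mulr_ge0 ?prod_step_ge0 //.
  have := bound 1 w (expr1n _ _); lra.
- move=> w; rewrite add_lfunE id_lfunE opp_lfunE innerDl -scaleN1r innerZl.
  rewrite inner_scaled_laplacian /inner.
  rewrite mulrCA -mulrDr mulr_ge0 ?prod_step_ge0 //.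
  have := bound (-1) w; rewrite sqrrN expr1n => /(_ erefl); lra.
Qed.

(* The formula for Lambda_k survives on the faces in the other directions,
   where both sides vanish; this is what makes the Lambda_k commute. *)
Lemma Lambda_upd k j (i : 'I_(N j).+1) w x : x \in omega N -> j != k ->
  vsval (Lambda N h k w) (upd i x)
  = (h k ^+ 2)^-1 * (vsval w (next k (upd i x)) - 2 * vsval w (upd i x)
                     + vsval w (prev k (upd i x))).
Proof.
move=> xo jk; rewrite LambdaE ffunE; case: ifPn => // yo.
have out y : y j = i -> vsval w y = 0.
  move=> yi; apply: vsval_out; apply: contra yo => yo.
  rewrite inE; apply/forallP => l; have [jl|jl] := eqVneq j l.
    by case: l / jl; rewrite upd_in -yi; exact: omega_coord.
  by rewrite upd_out //; exact: omega_coord.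
have kj : k != j by rewrite eq_sym.
have -> : vsval w (next k (upd i x)) = 0 by rewrite out // nextE upd_out // upd_in.
have -> : vsval w (prev k (upd i x)) = 0 by rewrite out // prevE upd_out // upd_in.
have -> : vsval w (upd i x) = 0 by rewrite out // upd_in.
by rewrite mulr0 subr0 addr0 mulr0.
Qed.

Lemma Lambda_comm k j : comm (Lambda N h k) (Lambda N h j).
Proof.
have [->|kj] := eqVneq k j; first exact: comm_refl.
move=> w; apply/val_inj/ffunP => x.
have [xo|xo] := boolP (x \in omega N); last by rewrite !vsval_out.
rewrite /= [in LHS]LambdaE [in RHS]LambdaE [LHS]ffunE [RHS]ffunE xo.
rewrite !nextE !prevE !Lambda_upd // 1?eq_sym // !LambdaE !ffunE xo.
rewrite !nextE !prevE !(upd_out _ _ kj) !(@upd_out j k) 1?eq_sym //.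
rewrite !(@updC k j) //; ring.
Qed.

Lemma scaled_laplacian_comm k j : comm (scaled_laplacian k) (scaled_laplacian j).
Proof. by apply/commZ/comm_sym/commZ/Lambda_comm. Qed.

End Laplacian.

End Mesh.

(** * Specialisation to the mesh and the stability threshold *)

Theorem mainTheorem4 (R : realType) (n : nat) (n_ge1 : (1 <= n)%N)
    (a X : 'I_n -> R) (a_gt0 : forall k, 0 < a k) (X_gt0 : forall k, 0 < X k)
    (N : 'I_n -> nat) (N_ge2 : forall k, (2 <= N k)%N)
    (T : R) (T_gt0 : 0 < T) (M : nat) (M_ge2 : (2 <= M)%N)
    (eps eps0 : R) (eps_bd : 0 <= eps < 1) (eps0_bd : 0 < eps0 < 1) :
  let h := step X N in
  let ht := T / M%:R in
  ht ^+ 2 * (\sum_k a k ^+ 2 / h k ^+ 2)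
    <= Num.min (3 * (1 - eps))
               (2^-1 * (3 - Num.sqrt (1 + 8 * eps0 ^+ 2))) ->
  3^-1 * ht ^+ 2 * (\sum_k a k ^+ 2 / h k ^+ 2) <= 1 - eps
  /\ op_le h ((4^-1 * ht ^+ 2) *: Aop N h a ht)
             ((1 - eps0 ^+ 2) *: \1%VF).
Proof.
move=> h ht; rewrite le_min => /andP[Heps Heps0]; split; first lra.
have h_gt0 k : 0 < h k.
  by rewrite divr_gt0 // ltr0n (leq_trans _ (N_ge2 k)).
pose c k := ht ^+ 2 * (a k ^+ 2 / h k ^+ 2).
pose Y k : 'End(Hh R N) := scaled_laplacian N h k.
have cE : ht ^+ 2 * (\sum_k a k ^+ 2 / h k ^+ 2) = \sum_k c k by rewrite mulr_sumr.
rewrite cE in Heps0.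
set r := Num.sqrt _ in Heps0.
have r0 : 0 <= r := sqrtr_ge0 _.
have r2 : r ^+ 2 = 1 + 8 * eps0 ^+ 2.
  by rewrite sqr_sqrtr // addr_ge0 // mulr_ge0 // sqr_ge0.
(* The threshold (3 - r) / 2 is the smaller root of C^2 - 3 C + 2 (1 - eps0^2), whose discriminant
   is r^2. From r >= 1 this root is at most 1, hence [c1]. *)
have r1 : 1 <= r.
  rewrite -(@ler_pXn2r _ 2) ?nnegrE // expr1n r2 lerDl.
  by rewrite mulr_ge0 // sqr_ge0.
have c0 k : 0 <= c k by rewrite mulr_ge0 ?divr_ge0 ?sqr_ge0.
have c1 : \sum_k c k <= 1 by lra.
have sE k : sN R N k = (\1 - 3^-1 *: Y k)%VF.
  rewrite (@sN_Lambda _ _ _ h) ?gt_eqF // /Y /scaled_laplacian.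
  rewrite scalerA -scaleNr; by congr (_ + _ *: _); field.
have sK k : cancel (\1 - 3^-1 *: Y k)%VF (sN R N k)^-1%VF.
  by rewrite -sE; apply: lker0_lfunK; apply/eqP/sN_invertible.
have sVK k : cancel (sN R N k)^-1%VF (\1 - 3^-1 *: Y k)%VF.
  by rewrite -sE; apply: lker0_lfunVK; apply/eqP/sN_invertible.
(* Here h_t^2 a_k^2 Lambda_k = - 4 c_k Y_k: the 1/12 in the first factor becomes - 1/3, and the
   outer 1/4 is absorbed by the second factor. *)
have AE : (4^-1 * ht ^+ 2) *: Aop N h a ht
    = ((\1 - 3^-1 *: \sum_k c k *: Y k)
       \o \sum_k c k *: ((sN R N k)^-1 \o Y k))%VF.
  rewrite /Aop comp_lfunZr; congr (_ \o _)%VF.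
    congr (_ + _); rewrite /Lop !scaler_sumr -sumrN; apply: eq_bigr => k _.
    rewrite !scalerA -scaleNr; congr (_ *: _); rewrite /c.
    by field; rewrite gt_eqF.
  rewrite scaler_sumr; apply: eq_bigr => k _.
  rewrite -scaleNr /Y /scaled_laplacian -comp_lfunZr !scalerA; congr (_ *: _).
  by rewrite /c; field; rewrite gt_eqF.
move=> w; rewrite AE.
have := numerov_bound (@innerC _ _ _ h) (@innerDl _ _ _ h) (@innerZl _ _ _ h)
  (inner_ge0 h_gt0) (scaled_laplacian_effect N h_gt0) (@scaled_laplacian_comm n N R h)
  sK sVK c0 c1 w.
move=> /le_trans; apply.
rewrite scale_lfunE id_lfunE innerZl ler_wpM2r ?inner_ge0 //.
(* Squaring 0 <= r <= 3 - 2 C says that the quadratic is nonnegative at C, that is (3/2) (C - C^2 /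
   3) <= 1 - eps0^2. *)
have : r ^+ 2 <= (3 - 2 * \sum_k c k) ^+ 2.
  by rewrite ler_pXn2r ?nnegrE //; lra.
rewrite r2; lra.
Qed.
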